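(* Let $(Q,\star)$ be a cyclic group of odd order $n$ with identity element $1$. Let $R_1$ be the right translation of $(Q,\star)$ by $1$ and let $\varphi_1$ be the right middle translation of $(Q,\star)$ at $1$. Define a binary operation $+$ on $Q$ by $$x+y=R_1(y)\star\varphi_1(x)\star y\qquad\text{for all }x,y\in Q.$$ Then $(Q,+)$ is a RIPQ of odd order $n$.
   Context: For a quasigroup $(Q,\star)$ and $i\in Q$: the right translation is $R_i(x)=x\star i$; the right middle translation $\varphi_i:Q\to Q$ is the permutation determined by $x\star\varphi_i(x)=i$ for all $x\in Q$. A groupoid $(Q,\circ)$ is a latin quandle if it is idempotent ($x\circ x=x$), for all $a,b\in Q$ each of the equations $a\circ x=b$ and $y\circ a=b$ has a unique solution in $Q$, and it is left and right distributive: $a\circ(x\circ y)=(a\circ x)\circ(a\circ y)$ and $(x\circ y)\circ a=(x\circ a)\circ(y\circ a)$ for all $a,x,y\in Q$. A RIPQ is a latin quandle $(Q,\circ)$ with the right involutory property $(y\circ x)\circ x=y$ for all $x,y\in Q$. *)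

(* Defs.v *)
From HB Require Import structures.
From mathcomp Require Import all_boot all_fingroup all_solvable.

Set Implicit Arguments.
Unset Strict Implicit.
Unset Printing Implicit Defensive.

Definition quasigroup (Q : Type) (op : Q -> Q -> Q) : Prop :=
  (forall a b, exists! x, op a x = b) /\ (forall a b, exists! y, op y a = b).

Definition right_translation (Q : Type) (op : Q -> Q -> Q) (i x : Q) : Q :=
  op x i.

Lemma quasigroup_solve (Q : choiceType) (op : Q -> Q -> Q) :
  quasigroup op -> forall i x, exists y, op x y == i.
Proof. by case=> opl _ i x; have [y [opxy _]] := opl x i; exists y; apply/eqP. Qed.

(* The choice is immaterial: the solution y of [op x y = i] is unique. *)
Definition right_middle_translation (Q : choiceType) (op : Q -> Q -> Q)
    (op_qg : quasigroup op) (i x : Q) : Q :=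
  xchoose (quasigroup_solve op_qg i x).

Lemma right_middle_translationP (Q : choiceType) (op : Q -> Q -> Q)
    (op_qg : quasigroup op) (i x : Q) :
  op x (right_middle_translation op_qg i x) = i.
Proof. exact/eqP/(xchooseP (quasigroup_solve op_qg i x)). Qed.

Lemma right_middle_translation_bij (Q : choiceType) (op : Q -> Q -> Q)
    (op_qg : quasigroup op) (i : Q) :
  bijective (right_middle_translation op_qg i).
Proof.
have [opl opr] := op_qg.
have ex y : exists x, op x y == i.
  by have [x [opxy _]] := opr y i; exists x; apply/eqP.
exists (fun y => xchoose (ex y)) => [x | y].
  set y := right_middle_translation op_qg i x.
  have [z [_ uz]] := opr y i.
  rewrite -(uz _ (eqP (xchooseP (ex y)))); apply: uz.
  exact: right_middle_translationP.
set x := xchoose (ex y).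
have [z [_ uz]] := opl x i.
rewrite -(uz _ (right_middle_translationP op_qg i x)); apply: uz.
exact: (eqP (xchooseP (ex y))).
Qed.

Lemma mulg_quasigroup (gT : groupType) : quasigroup (@monoid.mul gT).
Proof.
split=> a b.
  by exists (a^-1 * b)%g; split=> [|x <-]; rewrite ?mulKg ?mulKVg.
by exists (b * a^-1)%g; split=> [|x <-]; rewrite ?mulgK ?mulgKV.
Qed.

Record latin_quandle (Q : Type) (op : Q -> Q -> Q) : Prop := LatinQuandle {
  lq_idem : idempotent_op op;
  lq_quasigroup : quasigroup op;
  lq_distrl : forall a x y, op a (op x y) = op (op a x) (op a y);
  lq_distrr : forall a x y, op (op x y) a = op (op x a) (op y a)
}.

Definition RIPQ (Q : Type) (op : Q -> Q -> Q) : Prop :=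
  latin_quandle op /\ (forall x y, op (op y x) x = y).

(* Main.v *)
Require Import Defs.
From mathcomp Require Import all_boot all_fingroup all_solvable.

(** Since [phi1] is inversion, the operation is [x + y = y * x^-1 * y], the core
    of the group.  Right distributivity and the right involutory property hold in
    every group; commutativity gives left distributivity; and [a + x = b] reads
    [x ^+ 2 = a * b], which odd order makes uniquely solvable. *)

Definition core_op {gT : groupType} (x y : gT) : gT := (y * x^-1 * y)%g.

Section Core.

Local Open Scope group_scope.

Lemma right_middle_translation1 (gT : groupType) (x : gT) :
  right_middle_translation (mulg_quasigroup gT) 1 x = x^-1.
Proof.
by apply: (mulgI x); rewrite right_middle_translationP mulgV.
Qed.

Lemma core_op_idem {gT : groupType} : idempotent_op (@core_op gT).
Proof. by move=> x; rewrite /core_op mulgV mul1g. Qed.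

Lemma core_op_involutory {gT : groupType} (x y : gT) :
  core_op (core_op y x) x = y.
Proof. by rewrite /core_op !invMg invgK !mulgA mulgV mul1g mulgKV. Qed.

(** The inner factors [a] and [a^-1] cancel on the right, so both sides reduce to
    [a * y^-1 * x * y^-1 * a]. *)
Lemma core_op_distrr {gT : groupType} (a x y : gT) :
  core_op (core_op x y) a = core_op (core_op x a) (core_op y a).
Proof. by rewrite /core_op !invMg !invgK !mulgA !mulgK !mulgKV. Qed.

Lemma core_op_distrl {gT : groupType} (mulgC : commutative (@monoid.mul gT))
    (a x y : gT) :
  core_op a (core_op x y) = core_op (core_op a x) (core_op a y).
Proof.
(* With squaring an endomorphism, both sides acquire the leading factor [(y ^+ 2) ^+ 2], which
   [congr] removes. *)
have coreE (u v : gT) : core_op u v = v ^+ 2 * u^-1.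
  by rewrite /core_op mulgC mulgA.
have sqrM (u v : gT) : (u * v) ^+ 2 = u ^+ 2 * v ^+ 2.
  by rewrite expgMn //; apply: mulgC.
rewrite !coreE !sqrM invMg invgK !expgVn -[LHS]mulgA -[RHS]mulgA; congr (_ * _).
(* After cancelling [(x ^+ 2)^-1] as well, what remains is [a^-1 = (a ^+ 2)^-1 * a]. *)
by rewrite mulgA [RHS]mulgC; congr (_ * _); rewrite expg2 invMg mulgKV.
Qed.

(** For odd order [n] the half of [n.+1] is exact, and [z ^+ n.+1 = z] by Lagrange; hence squaring
    and the power [n.+1./2] are mutually inverse. *)
Lemma odd_card_sqrtg {gT : finGroupType} (oddT : odd #|[set: gT]|) (x y : gT) :
  x ^+ 2 = y <-> x = y ^+ (#|[set: gT]|.+1)./2.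
Proof.
have sqrtK (z : gT) : z ^+ ((#|[set: gT]|.+1)./2 * 2) = z.
  by rewrite muln2 even_halfK //= ?oddT // expgS expg_cardG ?inE ?mulg1.
by split=> [<- | ->]; rewrite -expgM ?sqrtK // mulnC sqrtK.
Qed.

Lemma core_op_quasigroup {gT : finGroupType}
    (mulgC : commutative (@monoid.mul gT)) (oddT : odd #|[set: gT]|) :
  quasigroup (@core_op gT).
Proof.
split=> a b.
  have eqE (x : gT) : core_op a x = b <-> x ^+ 2 = a * b.
    rewrite /core_op mulgC mulgA -expg2 [a * b]mulgC.
    by split=> [<- | ->]; rewrite ?mulgKV ?mulgK.
  exists ((a * b) ^+ (#|[set: gT]|.+1)./2); split=> [|x].
    by apply/eqE/(odd_card_sqrtg oddT).
  by move/eqE/(odd_card_sqrtg oddT).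
(* Right translation by [a] is an involution, so applying it to [b] gives the only solution of
   [core_op y a = b]. *)
exists (core_op b a); split=> [|y <-]; exact: core_op_involutory.
Qed.

Lemma core_op_RIPQ {gT : finGroupType}
    (mulgC : commutative (@monoid.mul gT)) (oddT : odd #|[set: gT]|) :
  RIPQ (@core_op gT).
Proof.
split; last exact: core_op_involutory.
split; first exact: core_op_idem.
- exact: core_op_quasigroup.
- exact: core_op_distrl.
- exact: core_op_distrr.
Qed.

End Core.

Theorem theorem2p4 (gT : finGroupType) (n : nat)
    (Qcyclic : cyclic [set: gT]) (Qorder : #|[set: gT]| = n) (n_odd : odd n) :
  let R1 := right_translation (@monoid.mul gT) 1%g in
  let phi1 := right_middle_translation (mulg_quasigroup gT) 1%g in
  let add := fun x y : gT => (R1 y * phi1 x * y)%g in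
  RIPQ add /\ #|gT| = n /\ odd n.
Proof.
move=> R1 phi1 add; split; last by rewrite -cardsT.
(* [R1] is the identity map and [phi1] is inversion. The agreement is pointwise, so each law is
   carried over separately below. *)
have addE x y : add x y = core_op x y.
  by rewrite /add /R1 /right_translation mulg1 /phi1 right_middle_translation1.
have mulgC : commutative (@monoid.mul gT).
  by move=> x y; apply: (centsP (cyclic_abelian Qcyclic)); rewrite inE.
have oddT : odd #|[set: gT]| by rewrite Qorder.
have [[idem [solvl solvr] distrl distrr] invol] := core_op_RIPQ mulgC oddT.
split; last by move=> x y; rewrite !addE.
split.
- by move=> x; rewrite addE.
- split=> a b.
    have [x [ax ux]] := solvl a b.
    by exists x; split=> [|z]; rewrite addE //; apply: ux.
  have [y [ya uy]] := solvr a b.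
  by exists y; split=> [|z]; rewrite addE //; apply: uy.
- by move=> a x y; rewrite !addE.
- by move=> a x y; rewrite !addE.
Qed.
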